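(* For all $\varepsilon>0$ there is $M$ such that the following holds. Let $(\lambda,\tau)\in(0,1)\times\mathbb{R}$ be such that $h(\lambda,\tau)<\frac23\log2-\varepsilon$. Then $M(\lambda)\le M$.
   Context: $H(\cdot)$ is Shannon entropy (natural logarithm). Let $T_1(Y_1,Y_2)=0$, $T_2(Y_1,Y_2)=Y_1$, $T_3(Y_1,Y_2)=Y_2$, and let $\xi_0,\xi_1,\dots$ be independent random variables taking the values $1,2,3$ with equal probability. For $(\lambda,\tau)\in(0,1)\times\mathbb{R}$ and $n\ge 0$ put $A_{\lambda,\tau}^{(n)}=\sum_{k=0}^{n-1}T_{\xi_k}(1,\tau)\lambda^k$ and $h(\lambda,\tau)=\lim_n\frac1nH(A_{\lambda,\tau}^{(n)})=\inf_{n\ge 1}\frac1nH(A_{\lambda,\tau}^{(n)})$. Mahler measure: if $\lambda$ is algebraic with minimal polynomial $a_n(x-\lambda_1)\cdots(x-\lambda_n)\in\mathbb{Z}[x]$ over $\mathbb{Z}$, then $M(\lambda)=|a_n|\prod_{j:|\lambda_j|>1}|\lambda_j|$; if $\lambda$ is transcendental, $M(\lambda)=\infty$. *)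

(* Defs.v *)
From HB Require Import structures.
From mathcomp Require Import all_boot all_order all_algebra.
From mathcomp Require Import finmap.
From mathcomp Require Import all_classical all_reals all_analysis.
From mathcomp.real_closed Require Import complex.

Set Implicit Arguments.
Unset Strict Implicit.
Unset Printing Implicit Defensive.

Import Order.TTheory GRing.Theory Num.Theory.
Import numFieldNormedType.Exports.

Local Open Scope classical_set_scope.
Local Open Scope ring_scope.

Definition mutually_independent {R : realType} {d d' : measure_display}
    {Omega : measurableType d} {E : measurableType d'}
    (P : probability Omega R) (X : nat -> {RV P >-> E}) : Prop :=
  forall (J : {fset nat}) (B : nat -> set E),
    (forall j, measurable (B j)) ->
    P (\bigcap_(j in [set` J]) (X j @^-1` B j)) =
      (\prod_(j <- J) P (X j @^-1` B j))%E.

(* Shannon entropy in nats of a function with finitely many values (a [\in]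
   sum of infinite support would be 0). *)
Definition entropy {R : realType} {d : measure_display}
    {Omega : measurableType d} (P : probability Omega R) (X : Omega -> R) : R :=
  \sum_(x \in range X)
    (let p := fine (P (X @^-1` [set x])) in - (p * ln p)).

(* The linear forms [T_1], [T_2], [T_3]; other indices are irrelevant. *)
Definition Tform {R : realType} (j : nat) (y1 y2 : R) : R :=
  match j with
  | 2%N => y1
  | 3%N => y2
  | _ => 0
  end.

Definition digit_sum {R : realType} {Omega : Type} (xi : nat -> Omega -> nat)
    (lambda tau : R) (n : nat) (omega : Omega) : R :=
  \sum_(0 <= k < n) Tform (xi k omega) 1 tau * lambda ^+ k.

Definition entropy_rate {R : realType} {d : measure_display}
    {Omega : measurableType d} (P : probability Omega R)
    (xi : nat -> {RV P >-> nat}) (lambda tau : R) : R :=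
  limn (fun n : nat => n%:R^-1 * entropy P (digit_sum xi lambda tau n)).

Definition algebraic_over_Z {R : realType} (lambda : R) : Prop :=
  exists2 q : {poly int}, q != 0 & root (map_poly intr q) lambda.

(* [zcontents p] carries the sign of the leading coefficient, so
   [zcontents p = 1] says that [p] is primitive with positive leading
   coefficient; this makes the minimal polynomial over Z unique. *)
Definition is_minpolyZ {R : realType} (lambda : R) (p : {poly int}) : Prop :=
  [/\ root (map_poly intr p) lambda,
      zcontents p = 1 &
      forall q : {poly int}, q != 0 -> root (map_poly intr q) lambda ->
        (size p <= size q)%N].

Definition minpolyZ {R : realType} (lambda : R) : {poly int} :=
  xget 0 [set p | is_minpolyZ lambda p].

(* The complex roots of [p], with multiplicity. *)
Definition complex_roots (R : realType) (p : {poly int}) : seq (complex R) :=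
  sval (closed_field_poly_normal (map_poly (intr : int -> complex R) p)).

Definition mahler_poly (R : realType) (p : {poly int}) : R :=
  `|lead_coef p|%:~R *
  \prod_(z <- complex_roots R p | 1 < Normc.normc z)
    Normc.normc z.

Definition mahler {R : realType} (lambda : R) : \bar R :=
  if `[< algebraic_over_Z lambda >] then (mahler_poly R (minpolyZ lambda))%:E
  else +oo%E.

(* Main.v *)
Require Import Defs.
From mathcomp Require Import all_boot all_order all_algebra.
From mathcomp Require Import all_classical all_reals all_analysis.
From mathcomp Require Import finmap complex ring lra.
Import Order.TTheory GRing.Theory Num.Theory.
Import numFieldNormedType.Exports.

Set Implicit Arguments.
Unset Strict Implicit.
Unset Printing Implicit Defensive.

Local Open Scope classical_set_scope.
Local Open Scope ring_scope.

(** Fix a set [J] of positions and condition on the event that [T_3] is used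
    exactly outside [J]. Then [tau] contributes a constant, and what remains is
    a sum of [b_k * lambda ^+ k] over [J] with independent fair bits [b_k]. Since
    [J] has mean density [2/3], it is enough to show that such a sum has entropy
    at least [#|J| * (ln 2 - eps)] once [M(lambda)] is large. By
    [unif_entropy_ge] this follows from a bound on the collision probability:
    with [c_k] the difference of two independent bits,
    [P(sum c_k lambda^k = 0) <= (e^eps / 2) ^ #|J|].

    If no nonzero polynomial with coefficients in [{-1, 0, 1}] vanishes at
    [lambda], the sums are pairwise distinct. Otherwise the minimal polynomial
    [p] is monic of some degree [d], and the event is that [p] divides
    [X = sum c_k x^k]. Multiply by [x^d] and replace the indicator of this event
    by the Gaussian weight [exp (- eps/2 * B_0 X X)], where [B_0] is the inner
    product of remainders modulo [p]. Let [B_k X X] be the least squared norm of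
    a polynomial of degree less than [d + k] congruent to [X] modulo [p]
    ([lsq_form]). Passing from [B_k] to [B_(k+1)] makes the monomial
    [v = x^(d+k)] available; this is a rank-one update, and it increases the
    expected Gaussian weight. The point is that for position [k] in [J] it
    increases at least by the factor [2 / e^eps], provided that [t = B_k v v] is
    large. When the other digits contribute [0], this is because before the
    update essentially only [c_k = 0], half of the mass, counts, whereas after it
    [B_(k+1) v v = t / (1 + t)] is less than [1] and every value of [c_k] has
    weight close to [1]. As the law of [c_k] is symmetric, the cross terms
    combine into hyperbolic cosines, and the same comparison holds pointwise in
    the other digits ([gauss_step]). After all updates the weight is at most [1],
    which gives the bound ([collision_bound]).

    The Mahler measure enters through [t]: subtracting from [v] its best
    representation gives a monic multiple of [p] of squared norm [1 + t], which
    by Landau's inequality is at least [M(p)^2] ([landau_ineq],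
    [lsq_form_new_monomial], [mahler_le_sqnorm]).

    Finally the limit defining the entropy rate exists by subadditivity
    ([word_entropyD], [subadditive_cvgn]), so the bound for every [n] passes to
    the limit. *)

(** * Landau's inequality *)

Definition sqnorm (F : numDomainType) (p : {poly F}) : F :=
  \sum_(i < size p) `|p`_i| ^+ 2.

Lemma sqnorm_widen (F : numDomainType) (p : {poly F}) n :
  (size p <= n)%N -> sqnorm p = \sum_(i < n) `|p`_i| ^+ 2.
Proof.
move=> pn; rewrite /sqnorm (big_ord_widen _ (fun i => `|p`_i| ^+ 2) pn).
rewrite big_mkcond; apply: eq_bigr => i _; case: ltnP => // pi.
by rewrite nth_default // normr0 expr0n.
Qed.

Lemma le_coef_sqnorm (F : numDomainType) (p : {poly F}) n :
  `|p`_n| ^+ 2 <= sqnorm p.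
Proof.
have [np|pn] := ltnP n (size p); last first.
  rewrite nth_default // normr0 expr0n; apply: sumr_ge0 => i _.
  exact: exprn_ge0.
rewrite /sqnorm (bigD1 (Ordinal np)) //= lerDl; apply: sumr_ge0 => i _.
exact: exprn_ge0.
Qed.

Lemma sqnorm_shift (F : numDomainType) (p : {poly F}) n :
  (size p <= n)%N -> sqnorm ('X * p) = sqnorm p.
Proof.
move=> pn; have [-> |p0] := eqVneq p 0; first by rewrite mulr0.
rewrite /sqnorm -commr_polyX size_mulX // big_ord_recl coefMX /= normr0 expr0n add0r.
by apply: eq_bigr => i _; rewrite coefMX.
Qed.

(** Pointwise on the unit circle, [|x - a| = |conj a * x - 1|]; here this is
    seen on coefficients, where the cross terms match and the remaining
    difference [(1 - |a|^2) * (sqnorm ('X * q) - sqnorm q)] vanishes. *)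
Lemma sqnorm_reflect (C : numClosedFieldType) (a : C) (q : {poly C}) :
  sqnorm (('X - a%:P) * q) = sqnorm ((a^* *: 'X - 1) * q).
Proof.
pose n := (size q).+1.
have sXq : (size ('X * q)%R <= n)%N.
  by rewrite (leq_trans (size_polyMleq _ _)) // size_polyX.
have sq : (size q <= n)%N by [].
have sL : (size (('X - a%:P) * q)%R <= n)%N.
  by rewrite (leq_trans (size_polyMleq _ _)) // size_XsubC.
have sR : (size ((a^* *: 'X - 1) * q)%R <= n)%N.
  rewrite mulrBl mul1r -scalerAl (leq_trans (size_polyD _ _)) //.
  by rewrite geq_max size_polyN sq andbT (leq_trans (size_scale_leq _ _)).
have coefL i : (('X - a%:P) * q)`_i = ('X * q)`_i - a * q`_i.
  by rewrite mulrBl coefB mul_polyC coefZ.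
have coefR i : ((a^* *: 'X - 1) * q)`_i = a^* * ('X * q)`_i - q`_i.
  by rewrite mulrBl mul1r coefB -scalerAl coefZ.
apply/eqP; rewrite -subr_eq0 (sqnorm_widen sL) (sqnorm_widen sR) -sumrB.
rewrite (eq_bigr (fun i : 'I_n =>
  (1 - a * a^*) * (`|('X * q)`_i| ^+ 2 - `|q`_i| ^+ 2))) => [|i _]; last first.
  rewrite coefL coefR !normCK !rmorphB !rmorphM /= conjCK; ring.
rewrite -mulr_sumr sumrB -(sqnorm_widen sXq) -(sqnorm_widen sq).
by rewrite (sqnorm_shift sq) subrr mulr0.
Qed.

(** Replacing each factor [x - z] by its reflection [conj z * x - 1] keeps the
    norm and multiplies the top coefficient by [conj z]. *)
Lemma landau_ineq (C : numClosedFieldType) (s : seq C) (q : {poly C}) n :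
  (size q <= n.+1)%N ->
  \prod_(z <- s) `|z| ^+ 2 * `|q`_n| ^+ 2 <=
  sqnorm (\prod_(z <- s) ('X - z%:P) * q).
Proof.
elim: s q n => [|z s IH] q n qn.
  by rewrite !big_nil !mul1r le_coef_sqnorm.
rewrite !big_cons -[in leRHS]mulrA sqnorm_reflect [in leRHS]mulrCA.
have top : ((z^* *: 'X - 1) * q)`_n.+1 = z^* * q`_n.
  rewrite mulrBl mul1r coefB -scalerAl coefZ coefXM /=.
  by rewrite (nth_default 0 qn) subr0.
have szr : (size ((z^* *: 'X - 1) * q)%R <= n.+2)%N.
  rewrite mulrBl mul1r -scalerAl (leq_trans (size_polyD _ _)) //.
  rewrite geq_max size_polyN (leq_trans qn) // andbT.
  rewrite (leq_trans (size_scale_leq _ _)) // (leq_trans (size_polyMleq _ _)) //.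
  by rewrite size_polyX.
by apply: le_trans (IH _ _ szr); rewrite top normrM norm_conjC exprMn [leRHS]mulrCA mulrA.
Qed.

(** * Least-squares forms on the quotient by a polynomial *)

(** [lsq_form P k X X] is the least squared norm of a polynomial of degree less
    than [d + k] congruent to [X] modulo [P], with [d] the degree of [P]; see
    [lsq_form_attained]. Its matrix is the inverse of the sum of [v * v^T] over the
    remainders [v] of the available monomials, and the recursion is the
    Sherman-Morrison formula for adding one more. *)
Fixpoint lsq_form (F : fieldType) (P : {poly F}) (k : nat) (X Y : {poly F}) : F :=
  if k is k'.+1 then
    let v := 'X^((size P).-1 + k') in
    lsq_form P k' X Y -
      lsq_form P k' X v * lsq_form P k' v Y / (1 + lsq_form P k' v v)
  else \sum_(i < (size P).-1) (X %% P)`_i * (Y %% P)`_i.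

Lemma lsq_formC (F : fieldType) (P : {poly F}) k X Y :
  lsq_form P k X Y = lsq_form P k Y X.
Proof.
elim: k X Y => [|k IH] X Y /=; first by apply: eq_bigr => i _; rewrite mulrC.
rewrite (IH X Y) (IH _ Y) (IH X); congr (_ - _ / _); exact: mulrC.
Qed.

Lemma lsq_formDl (F : fieldType) (P : {poly F}) k X X' Y :
  lsq_form P k (X + X') Y = lsq_form P k X Y + lsq_form P k X' Y.
Proof.
elim: k X X' Y => [|k IH] X X' Y /=; last by rewrite !IH; ring.
rewrite -big_split /=; apply: eq_bigr => i _.
by rewrite modpD coefD mulrDl.
Qed.

Lemma lsq_formZl (F : fieldType) (P : {poly F}) k a X Y :
  lsq_form P k (a *: X) Y = a * lsq_form P k X Y.
Proof.
elim: k X Y => [|k IH] X Y /=; last by rewrite !IH; ring.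
rewrite mulr_sumr; apply: eq_bigr => i _.
by rewrite modpZl coefZ mulrA.
Qed.

Lemma lsq_form_sqD (F : fieldType) (P : {poly F}) k a X v :
  lsq_form P k (X + a *: v) (X + a *: v) =
  lsq_form P k X X + 2 * a * lsq_form P k X v + a ^+ 2 * lsq_form P k v v.
Proof.
rewrite lsq_formDl (lsq_formC P k X) (lsq_formC P k (a *: v)) !lsq_formDl.
rewrite !lsq_formZl (lsq_formC P k X (a *: v)) lsq_formZl.
rewrite (lsq_formC P k v (a *: v)) lsq_formZl (lsq_formC P k v X); ring.
Qed.

(** The rank-one update of the form is the one that updates a least-squares
    minimum when the new monomial ['X^(d + k)] becomes available: in the optimal
    representation it is used with the coefficient
    [B X v / (1 + B v v)]. *)
Lemma lsq_form_attained (F : realFieldType) (P : {poly F}) k X :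
  P != 0 ->
  exists Y : {poly F}, [/\ (size Y <= (size P).-1 + k)%N, P %| X - Y &
    \sum_(i < (size P).-1 + k) Y`_i ^+ 2 = lsq_form P k X X].
Proof.
move=> P0; elim: k X => [|k IH] X.
  exists (X %% P); rewrite addn0; split.
  - by rewrite -ltnS (leq_trans (ltn_modpN0 X P0)) // leqSpred.
  - by apply/modp_eq0P; rewrite modpD modpN modp_id subrr.
  - by rewrite /=; apply: eq_bigr => i _; rewrite expr2.
pose v : {poly F} := 'X^((size P).-1 + k); pose t := lsq_form P k v v.
have t0 : 0 <= t.
  rewrite /t; have [V [_ _ <-]] := IH v.
  by apply: sumr_ge0 => i _; rewrite sqr_ge0.
pose c := lsq_form P k X v / (1 + t).
have [Y [sY dY nY]] := IH (X - c *: v).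
exists (Y + c *: v); split.
- rewrite addnS (leq_trans (size_polyD _ _)) // geq_max leqW //=.
  by rewrite (leq_trans (size_scale_leq _ _)) // size_polyXn.
- by rewrite (_ : _ - _ = X - c *: v - Y) // opprD addrA addrAC.
rewrite addnS big_ord_recr /= coefD coefZ coefXn eqxx mulr1.
rewrite (nth_default 0 sY) add0r (eq_bigr (fun i : 'I__ => Y`_i ^+ 2)); last first.
  by move=> i _; rewrite coefD coefZ coefXn ltn_eqF // mulr0 addr0.
rewrite nY -scaleNr lsq_form_sqD -/v (lsq_formC P k v X) -/t.
rewrite /c; field.
by rewrite gt_eqF // ltr_pwDl.
Qed.

Lemma lsq_form_ge0 (F : realFieldType) (P : {poly F}) k X :
  P != 0 -> 0 <= lsq_form P k X X.
Proof.
move=> /(lsq_form_attained k X)[Y [_ _ <-]].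
by apply: sumr_ge0 => i _; rewrite sqr_ge0.
Qed.

Lemma lsq_form_le (F : realFieldType) (P : {poly F}) k X :
  P != 0 -> lsq_form P k.+1 X X <= lsq_form P k X X.
Proof.
move=> P0 /=; rewrite gerBl (lsq_formC P k _ X) mulr_ge0 //.
  by rewrite -expr2 sqr_ge0.
by rewrite invr_ge0 addr_ge0 // lsq_form_ge0.
Qed.

Lemma lsq_form0_dvdp (F : fieldType) (P X : {poly F}) :
  P %| X -> lsq_form P 0 X X = 0.
Proof.
by move=> /modp_eq0P /= ->; apply: big1 => i _; rewrite coef0 mul0r.
Qed.

(** A best representation of the new monomial by the previous ones, subtracted
    from it, is a monic multiple of [P]; hence any lower bound on the norm of
    such multiples bounds the form from below. *)
Lemma lsq_form_new_monomial (F : realFieldType) (P : {poly F}) (m : F) k :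
  P != 0 ->
  (forall G : {poly F}, G \is monic -> P %| G -> m <= sqnorm G) ->
  m <= 1 + lsq_form P k 'X^((size P).-1 + k) 'X^((size P).-1 + k).
Proof.
move=> P0 mP; set n := (_ + k)%N.
have [Y [sY dY <-]] := lsq_form_attained k 'X^n P0.
have sG : size ('X^n - Y) = n.+1.
  by rewrite size_polyDl size_polyXn // size_polyN ltnS.
apply: le_trans (mP _ _ dY) _.
  by rewrite monicE lead_coefE sG /= coefB coefXn eqxx (nth_default 0 sY) subr0.
rewrite /sqnorm sG big_ord_recr /= coefB coefXn eqxx (nth_default 0 sY) subr0.
rewrite normr1 expr1n addrC lerD2l le_eqVlt; apply/orP; left; apply/eqP.
apply: eq_bigr => i _; rewrite coefB coefXn ltn_eqF // sub0r normrN.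
by rewrite real_normK // num_real.
Qed.

(** * Removing one digit from the Gaussian collision sum *)

Definition gauss (R : realType) (s : R) (P : {poly R}) k (X : {poly R}) : R :=
  expR (- (s / 2) * lsq_form P k X X).

(** Put [S = eps * (1 + t)] and [z = eps * |y|]. The left side is
    [2 + 2 * exp (eps/2 - S/2) * cosh z]. If [z] is small compared with [S] the
    second term is negligible; otherwise it is at most about half of the right
    side, and the Gaussian factor [exp (z^2 / (2 S))] is large enough for the
    other half to absorb the constant. *)
Lemma cosh_le_gauss (R : realType) (eps : R) : 0 < eps ->
  exists T : R, forall t y : R, 0 <= t -> T <= eps * (1 + t) ->
    2 + expR (- (eps / 2) * (t + 2 * y)) + expR (- (eps / 2) * (t - 2 * y)) <=
    2 * expR (eps / 2) * expR (eps / 2 * (y ^+ 2 / (1 + t))).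
Proof.
move=> e0.
have q1 : 0 < 1 - expR (- (eps / 2)) by rewrite subr_gt0 expR_lt1; lra.
(* [64] gives [exp (S / 32) >= 3]; the other bound gives
   [exp (- S / 4) <= 1 - exp (- eps / 2)]. *)
pose T := Num.max 64 (4 / (1 - expR (- (eps / 2)))).
exists T => t y t0 Tt.
wlog y0 : y / 0 <= y => [wlg|].
  have [/wlg//|y0] := leP 0 y.
  have := wlg (- y) (ltW _); rewrite oppr_gt0 sqrrN mulrN opprK => /(_ y0).
  by rewrite addrAC.
set S := eps * (1 + t) in Tt; pose z := eps * y.
have S64 : 64 <= S by apply: le_trans Tt; rewrite le_max lexx.
have S4 : 4 / S <= 1 - expR (- (eps / 2)).
  have : 4 / (1 - expR (- (eps / 2))) <= S by apply: le_trans Tt; rewrite le_max lexx orbT.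
  rewrite ler_pdivrMr // => ?; rewrite ler_pdivrMr ; last lra.
  by rewrite mulrC.
have z0 : 0 <= z by rewrite mulr_ge0 // ltW.
have -> : eps / 2 * (y ^+ 2 / (1 + t)) = z ^+ 2 / (2 * S).
  by rewrite /z /S; field; rewrite gt_eqF //= ?gt_eqF //; lra.
set u := expR (z ^+ 2 / _).
have -> : - (eps / 2) * (t + 2 * y) = eps / 2 - S / 2 - z by rewrite /S /z; field.
have -> : - (eps / 2) * (t - 2 * y) = eps / 2 - S / 2 + z by rewrite /S /z; field.
set a := expR (eps / 2).
have a1 : 1 <= a by rewrite -expR0 ler_expR; lra.
have zz : 0 <= z ^+ 2 / (2 * S) by rewrite divr_ge0 ?sqr_ge0 //; lra.
have [zS|zS] := leP z (S / 4).
  have u1 : 1 <= u by rewrite -expR0 ler_expR.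
  have b : expR (- (S / 4)) <= 1 - expR (- (eps / 2)).
    apply: le_trans S4; rewrite expRN -[leRHS]invf_div lef_pV2 ?posrE ?expR_gt0 //; last lra.
    by apply: le_trans (expR_ge1Dx _); lra.
  have c w : w <= z -> expR (eps / 2 - S / 2 + w) <= a - 1.
    move=> wz.
    have -> : a - 1 = a * (1 - expR (- (eps / 2))).
      by rewrite mulrBr mulr1 -expRD subrr expR0.
    apply: le_trans (ler_wpM2l _ b); last by lra.
    rewrite -expRD ler_expR; lra.
  have := c z (lexx _); have := c (- z) _ => /(_ ltac:(lra)) ? ?.
  have : a <= a * u by rewrite ler_peMr //; lra.
  lra.
have u3 : 3 <= u.
  apply: le_trans (expR_ge1Dx _).
  have : S / 32 <= z ^+ 2 / (2 * S).
    rewrite ler_pdivlMr; last lra.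
    nra.
  lra.
have c1 : expR (eps / 2 - S / 2 - z) <= a by rewrite ler_expR; lra.
(* complete the square in [z] *)
have c2 : expR (eps / 2 - S / 2 + z) <= a * u.
  rewrite -expRD ler_expR.
  have -> : z ^+ 2 / (2 * S) = z - S / 2 + (z - S) ^+ 2 / (2 * S).
    by field; lra.
  have : 0 <= (z - S) ^+ 2 / (2 * S) by rewrite divr_ge0 ?sqr_ge0 //; lra.
  lra.
nra.
Qed.

(** Here [v] is the monomial absorbed between levels [k] and [k.+1]; the four
    summands are the contributions of the four pairs of binary digits in front
    of [v]. *)
Lemma gauss_step (R : realType) (eps : R) : 0 < eps ->
  exists T : R, forall (P : {poly R}) k (Y : {poly R}), P != 0 ->
    let v := 'X^((size P).-1 + k) in
    T <= eps * (1 + lsq_form P k v v) ->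
    2 * gauss eps P k Y + gauss eps P k (Y + v) + gauss eps P k (Y - v) <=
    expR eps / 2 * (2 * gauss eps P k.+1 Y +
      gauss eps P k.+1 (Y + v) + gauss eps P k.+1 (Y - v)).
Proof.
move=> e0; have [T HT] := cosh_le_gauss e0.
exists T => P k Y P0 v; set t := lsq_form P k v v => Tt.
pose y := lsq_form P k Y v; pose w := lsq_form P k Y Y.
have t0 : 0 <= t by exact: lsq_form_ge0.
have t1 : 0 < 1 + t by rewrite ltr_pwDl.
have Bk c : lsq_form P k (Y + c *: v) (Y + c *: v) = w + 2 * c * y + c ^+ 2 * t.
  exact: lsq_form_sqD.
have Bk1 c : lsq_form P k.+1 (Y + c *: v) (Y + c *: v) =
    w - y ^+ 2 / (1 + t) + (2 * c * y + c ^+ 2 * t) / (1 + t).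
  rewrite /= -/v Bk (lsq_formC P k v) lsq_formDl lsq_formZl -/t -/y.
  by field; rewrite gt_eqF.
have E : forall X : {poly R}, [/\ X = X + 0 *: v, X + v = X + 1 *: v & X - v = X + (-1) *: v].
  by move=> X; rewrite scale0r addr0 scale1r scaleN1r.
have [E0 E1 E2] := E Y; rewrite E1 E2 {1 4}E0 /gauss !Bk !Bk1.
set u := expR (eps / 2 * (y ^+ 2 / (1 + t))).
set W := expR (- (eps / 2) * w).
have W0 : 0 < W by exact: expR_gt0.
have -> : - (eps / 2) * (w + 2 * 0 * y + 0 ^+ 2 * t) = - (eps / 2) * w by ring.
have -> : - (eps / 2) * (w + 2 * 1 * y + 1 ^+ 2 * t) =
  - (eps / 2) * w + - (eps / 2) * (t + 2 * y) by ring.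
have -> : - (eps / 2) * (w + 2 * -1 * y + (-1) ^+ 2 * t) =
  - (eps / 2) * w + - (eps / 2) * (t - 2 * y) by ring.
pose A := t / (1 + t); pose b := 2 * y / (1 + t).
have -> : - (eps / 2) * (w - y ^+ 2 / (1 + t) + (2 * 0 * y + 0 ^+ 2 * t) / (1 + t)) =
  - (eps / 2) * w + eps / 2 * (y ^+ 2 / (1 + t)) by ring.
have -> : - (eps / 2) * (w - y ^+ 2 / (1 + t) + (2 * 1 * y + 1 ^+ 2 * t) / (1 + t)) =
  - (eps / 2) * w + eps / 2 * (y ^+ 2 / (1 + t)) + - (eps / 2) * (A + b) by rewrite /A /b; ring.
have -> : - (eps / 2) * (w - y ^+ 2 / (1 + t) + (2 * -1 * y + (-1) ^+ 2 * t) / (1 + t)) =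
  - (eps / 2) * w + eps / 2 * (y ^+ 2 / (1 + t)) + - (eps / 2) * (A - b) by rewrite /A /b; ring.
rewrite !expRD -/W -/u.
have u0 : 0 < u by exact: expR_gt0.
apply: (@le_trans _ _ (W * (2 * expR (eps / 2) * u))).
  have := HT t y t0 Tt; rewrite -/u -(ler_pM2l W0); lra.
have A1 : A <= 1 by rewrite ler_pdivrMr // mul1r lerDr.
(* [exp a + exp (- a) >= 2] removes the cross term [b]. *)
have B2 : 2 * expR (- (eps / 2)) <=
    expR (- (eps / 2) * (A + b)) + expR (- (eps / 2) * (A - b)).
  apply: (@le_trans _ _ (2 * expR (- (eps / 2) * A))).
    by rewrite ler_pM2l // ler_expR; nra.
  rewrite mulrDr mulrBr !expRD; set p := expR (_ * A).
  have p0 : 0 < p by exact: expR_gt0.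
  rewrite -mulrDr mulrC ler_pM2l //.
  have := expR_ge1Dx (- (eps / 2) * b); have := expR_ge1Dx (- (- (eps / 2) * b)); lra.
set q := expR (- (eps / 2)) in B2.
have q1 : q <= 1 by rewrite expR_le1; lra.
have ee : expR eps = expR (eps / 2) * expR (eps / 2) by rewrite -expRD; congr expR; field.
have qe : expR (eps / 2) * q = 1 by rewrite -expRD subrr expR0.
set e := expR (eps / 2) in ee qe *; rewrite ee.
have e'0 : 0 < e by exact: expR_gt0.
set r := _ + _ in B2.
have -> : e * e / 2 * (2 * (W * u) + W * u * expR (- (eps / 2) * (A + b)) +
   W * u * expR (- (eps / 2) * (A - b))) = W * u * (e * (e / 2 * (2 + r))) by rewrite /r; ring.
have -> : W * (2 * e * u) = W * u * (e * 2) by ring.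
rewrite ler_pM2l ?mulr_gt0 // ler_pM2l //.
have : e * (2 * q + 2 * q) <= e * (2 + r) by rewrite ler_pM2l //; lra.
have -> : e * (2 * q + 2 * q) = 4 * (e * q) by ring.
rewrite qe; lra.
Qed.

(** * Counting collisions between words with the same free positions *)

Notation word n := {ffun 'I_n -> 'I_3}.

(** The digit [2] stands for the map [T_3]; the remaining digits [0] and [1]
    contribute [0] and [lambda ^+ i]. *)
Definition free n (w : word n) : {set 'I_n} := [set i | (w i < 2)%N].

Definition bit (R : comNzRingType) (a : 'I_3) : R := (a == 1%N :> nat)%:R.

Definition word_diff (R : comNzRingType) n (w w' : word n) : {poly R} :=
  \sum_(i < n) (bit R (w i) - bit R (w' i)) *: 'X^i.

Definition flip_digit (a : 'I_3) : 'I_3 :=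
  if a == 0%N :> nat then inord 1 else if a == 1%N :> nat then ord0 else a.

Definition flip n (k : 'I_n) (w : word n) : word n :=
  [ffun i => if i == k then flip_digit (w i) else w i].

Lemma flip_digitK : involutive flip_digit.
Proof.
move=> a; apply: val_inj; rewrite /flip_digit.
by case: a => [[|[|[|a]]]] //= a3; rewrite ?inordK.
Qed.

Lemma flip_digit_free (a : 'I_3) : (flip_digit a < 2)%N = (a < 2)%N.
Proof. by case: a => [[|[|[|a]]]] //= a3; rewrite /flip_digit /= ?inordK. Qed.

Lemma bit_flip (R : comNzRingType) (a : 'I_3) : (a < 2)%N -> bit R (flip_digit a) = 1 - bit R a.
Proof.
by case: a => [[|[|[|a]]]] //= a3 _; rewrite /flip_digit /bit /= ?inordK //=
  ?subrr ?subr0.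
Qed.

Lemma flipK n (k : 'I_n) : involutive (flip k).
Proof.
move=> w; apply/ffunP => i; rewrite !ffunE; case: eqP => // _.
exact: flip_digitK.
Qed.

Lemma free_flip n (k : 'I_n) w : free (flip k w) = free w.
Proof.
apply/setP => i; rewrite !inE ffunE; case: eqP => // _.
exact: flip_digit_free.
Qed.

Lemma word_diffC (R : comNzRingType) n (w w' : word n) :
  word_diff R w' w = - word_diff R w w'.
Proof.
rewrite /word_diff -sumrN; apply: eq_bigr => i _.
by rewrite -scaleNr opprB.
Qed.

Lemma word_diff_flip (R : comNzRingType) n (k : 'I_n) (w w' : word n) : k \in free w ->
  word_diff R (flip k w) w' = word_diff R w w' + (1 - bit R (w k) - bit R (w k)) *: 'X^k.
Proof.
rewrite inE => wk; rewrite /word_diff (bigD1 k) //= [in RHS](bigD1 k) //=.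
rewrite !ffunE eqxx bit_flip // -[RHS]addrA [in RHS]addrC -[RHS]addrA -scalerDl.
rewrite addrC; congr (_ + _ *: _).
  by apply: eq_bigr => i ik; rewrite ffunE (negbTE ik).
ring.
Qed.

Lemma sum_class_flip (R : nmodType) n (J : {set 'I_n}) (k : 'I_n) (G : word n -> R) :
  \sum_(w | free w == J) G (flip k w) = \sum_(w | free w == J) G w.
Proof.
rewrite [RHS](reindex_inj (inv_inj (flipK k))) /=.
by apply: eq_bigl => w; rewrite free_flip.
Qed.

Definition shifted_diff (R : comNzRingType) (P : {poly R}) n (w w' : word n) : {poly R} :=
  'X^((size P).-1) * word_diff R w w'.

Definition collision_sum (R : realType) (s : R) (P : {poly R}) k n
    (J : {set 'I_n}) : R :=
  \sum_(w : word n | free w == J) \sum_(w' : word n | free w' == J)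
    gauss s P k (shifted_diff P w w').

(** Flipping the digit at [k] in either word groups the pairs by four; within a
    group the differences are [Y], [Y], [Y + v] and [Y - v]. *)
Lemma sum_pairs_flip (R : realType) (P : {poly R}) n (J : {set 'I_n}) (k : 'I_n)
    (g : {poly R} -> R) : k \in J ->
  let v := 'X^((size P).-1 + k) in
  let Y w w' := shifted_diff P w w' - (bit R (w k) - bit R (w' k)) *: v in
  4 * \sum_(w : word n | free w == J) \sum_(w' : word n | free w' == J)
    g (shifted_diff P w w') =
  \sum_(w : word n | free w == J) \sum_(w' : word n | free w' == J)
    (2 * g (Y w w') + g (Y w w' + v) + g (Y w w' - v)).
Proof.
move=> kJ v Y; pose D (w w' : word n) := shifted_diff P w w'.
set S := \sum_(w | _) _.
have S1 : S = \sum_(w : word n | free w == J) \sum_(w' : word n | free w' == J)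
    g (D (flip k w) w').
  rewrite (sum_class_flip J k (fun w => \sum_(w' : word n | free w' == J) g (D w w'))).
  by [].
have S2 : S = \sum_(w : word n | free w == J) \sum_(w' : word n | free w' == J)
    g (D w (flip k w')).
  apply: eq_bigr => w _; exact: (esym (sum_class_flip J k (fun w' => g (D w w')))).
have S3 : S = \sum_(w : word n | free w == J) \sum_(w' : word n | free w' == J)
    g (D (flip k w) (flip k w')).
  rewrite S1; apply: eq_bigr => w _.
  exact: (esym (sum_class_flip J k (fun w' => g (D (flip k w) w')))).
have -> : 4 * S = S + S + (S + S) by ring.
rewrite {2}S1 {3}S2 {2}S3 -!big_split /=; apply: eq_bigr => w /eqP Jw.
rewrite -!big_split /=; apply: eq_bigr => w' /eqP Jw'.
have kw : k \in free w by rewrite Jw.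
have kw' : k \in free w' by rewrite Jw'.
have Df u u' : k \in free u ->
    D (flip k u) u' = D u u' + (1 - bit R (u k) - bit R (u k)) *: v.
  by move=> ku; rewrite /D /shifted_diff word_diff_flip // mulrDr -scalerAr -exprD.
have DC u u' : D u' u = - D u u' by rewrite /D /shifted_diff word_diffC mulrN.
have Df' u u' : k \in free u' ->
    D u (flip k u') = D u u' - (1 - bit R (u' k) - bit R (u' k)) *: v.
  by move=> ku; rewrite DC Df // opprD -DC.
have kfw : k \in free (flip k w) by rewrite free_flip.
rewrite !Df' // !Df // -/(D w w').
set d := D w w'.
have -> : d = Y w w' + (bit R (w k) - bit R (w' k)) *: v by rewrite subrK.
set y := Y w w'.
rewrite /bit; move: kw kw'; rewrite !inE.
case: (w k) => [[|[|a]]] //= _ _; case: (w' k) => [[|[|b]]] //= _ _;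
  rewrite ?(subrr, subr0, sub0r, scale0r, scale1r, addr0, add0r, opprK, oppr0,
  scaleNr, opprB, addrK, subrK, addNr, mulr1n, mulr0n) /=; ring.
Qed.

(** Going up one level costs a factor [expR eps / 2] at a free position and
    nothing at the others; at the top, every term is at most [1]. *)
Lemma collision_bound (R : realType) (eps : R) : 0 < eps ->
  exists T : R, forall P : {poly R}, P != 0 ->
    (forall k, T <= eps * (1 + lsq_form P k 'X^((size P).-1 + k) 'X^((size P).-1 + k))) ->
  forall n (J : {set 'I_n}),
    \sum_(w : word n | free w == J) \sum_(w' : word n | free w' == J)
      (P %| word_diff R w w')%R%:R <=
    (expR eps / 2) ^+ #|J| * #|[pred w : word n | free w == J]|%:R ^+ 2 :> R.
Proof.
move=> e0; have [T HT] := gauss_step e0.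
exists T => P P0 TP n J; set rho := expR eps / 2.
have rho0 : 0 < rho by rewrite divr_gt0 ?expR_gt0.
have step (k : 'I_n) : collision_sum eps P k J <=
    (if k \in J then rho else 1) * collision_sum eps P k.+1 J.
  case: ifPn => kJ; last first.
    rewrite mul1r; apply: ler_sum => w _; apply: ler_sum => w' _.
    by rewrite ler_expR ler_wnM2l ?lsq_form_le //; lra.
  rewrite -(ler_pM2l (ltr0n _ 4 : 0 < 4 :> R)) // mulrCA /collision_sum.
  rewrite !(sum_pairs_flip P (gauss _ _ _) kJ) /=.
  rewrite mulr_sumr; apply: ler_sum => w _.
  rewrite mulr_sumr; apply: ler_sum => w' _.
  exact: HT.
have bound k : (k <= n)%N -> collision_sum eps P 0 J <=
    \prod_(i < n | (i < k)%N) (if i \in J then rho else 1) * collision_sum eps P k J.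
  elim: k => [|k IH] kn; first by rewrite big_pred0 ?mul1r.
  apply: le_trans (IH (ltnW kn)) _.
  rewrite [X in _ <= X * _](bigD1 (Ordinal kn)) //=.
  rewrite [X in _ <= _ * X * _](eq_bigl (fun i : 'I_n => (i < k)%N)).
    rewrite mulrAC mulrC ler_wpM2r //; last exact: step (Ordinal kn).
    by apply: prodr_ge0 => i _; case: ifP => // _; exact: ltW.
  by move=> i; rewrite ltnS -val_eqE /= ltn_neqAle andbC.
have := bound n (leqnn _); rewrite (eq_bigl xpredT) => [|i]; last exact: ltn_ord.
rewrite -big_mkcond /= prodr_const => b.
apply: (@le_trans _ _ (collision_sum eps P 0 J)).
  apply: ler_sum => w _; apply: ler_sum => w' _.
  case: (boolP (P %| _)) => [Pd|_]; last exact: expR_ge0.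
  rewrite /gauss lsq_form0_dvdp ?mulr0 ?expR0 //.
  exact: dvdp_mull.
apply: le_trans b _; rewrite ler_wpM2l //; first exact: exprn_ge0 (ltW rho0).
have cst (c : R) : \sum_(w : word n | free w == J) c =
    c *+ #|[pred w : word n | free w == J]| by rewrite -sumr_const; apply: eq_bigl.
rewrite expr2 mulr_natl -!cst; apply: ler_sum => w _; apply: ler_sum => w' _.
rewrite -expR0 ler_expR mulNr oppr_le0 mulr_ge0 ?lsq_form_ge0 //; lra.
Qed.

(** * Entropy of a function of a uniform word *)

(** Entropy of [f] under the uniform law on [W], written as the mean over [W]
    of the information [- ln] of the fibre. *)
Definition unif_entropy (R : realType) (W : finType) (V : eqType) (f : W -> V) : R :=
  (\sum_(w : W) - ln (#|[pred w' | f w' == f w]|%:R / #|W|%:R)) / #|W|%:R.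

Lemma ln_le_subr1 (R : realType) (x : R) : 0 < x -> ln x <= x - 1.
Proof. by move=> x0; have := @le_ln1Dx R (x - 1); rewrite [1 + _]addrC subrK; apply; lra. Qed.

(** Conditioning on [c] does not increase the entropy, and the entropy of a
    conditional law is at least minus the logarithm of its collision
    probability. Both facts are instances of [ln x <= x - 1], applied to the
    ratio of the two fibre probabilities and to that of the conditional
    fibre probability and [r]. *)
Lemma unif_entropy_ge (R : realType) (W J : finType) (V : eqType)
    (f : W -> V) (c : W -> J) (r : J -> R) :
  (forall j, 0 < r j) ->
  (forall j, \sum_(w | c w == j) \sum_(w' | c w' == j) (f w == f w')%:R <=
    r j * #|[pred w | c w == j]|%:R ^+ 2) ->
  (\sum_(w : W) - ln (r (c w))) / #|W|%:R <= unif_entropy R f.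
Proof.
move=> r0 coll; rewrite ler_wpM2r ?invr_ge0 //.
set T : R := #|W|%:R.
pose N w : R := #|[pred w' | f w' == f w]|%:R.
pose K j : R := #|[pred w | c w == j]|%:R.
pose L w : R := #|[pred w' | (f w' == f w) && (c w' == c w)]|%:R.
have sumE (A : pred W) : #|A|%:R = \sum_(w | A w) 1 :> R by rewrite sumr_const.
have N0 w : 0 < N w by rewrite ltr0n; apply/card_gt0P; exists w; rewrite inE.
have K0 w : 0 < K (c w) by rewrite ltr0n; apply/card_gt0P; exists w; rewrite inE.
have L0 w : 0 < L w by rewrite ltr0n; apply/card_gt0P; exists w; rewrite inE !eqxx.
have [W0|/card_gt0P[w0 _]] := posnP #|W|.
  by rewrite !big1 // => w; have := card0_eq W0 w; rewrite inE.
have T0 : 0 < T by rewrite ltr0n; apply/card_gt0P; exists w0.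
have TE : T = \sum_(w : W) 1 by rewrite sumr_const.
(* a nonempty fibre of the pair [(f, c)] has total weight one *)
have fib v j : \sum_(w | (f w == v) && (c w == j)) (L w)^-1 <= 1.
  have [w1 /andP[/eqP fw /eqP cw]|none] := pickP (fun w => (f w == v) && (c w == j)); last first.
    by rewrite big_pred0.
  rewrite (eq_bigr (fun=> (L w1)^-1)) => [|w /andP[/eqP fw' /eqP cw']]; last first.
    by rewrite /L fw fw' cw cw'.
  rewrite -[X in \sum_(_ | _) X]mul1r -mulr_suml.
  have -> : \sum_(w | (f w == v) && (c w == j)) 1 = L w1.
    by rewrite /L sumE; apply: eq_bigl => w; rewrite inE fw cw.
  by rewrite mulfV // gt_eqF.
have S1 : \sum_w (N w / T) * (K (c w) / L w) <= T.
  have -> : \sum_w (N w / T) * (K (c w) / L w) =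
      (\sum_w1 \sum_w2 \sum_(w | (f w == f w1) && (c w == c w2)) (L w)^-1) / T.
    transitivity (\sum_w \sum_(w1 | f w1 == f w) \sum_(w2 | c w2 == c w) (L w)^-1 / T).
      apply: eq_bigr => w _; rewrite !sumr_const -mulrnA -mulr_natr natrM.
      by rewrite -/(K _) -/(N _); ring.
    rewrite (exchange_big_dep xpredT) //= mulr_suml; apply: eq_bigr => w1 _.
    rewrite (exchange_big_dep xpredT) //= mulr_suml; apply: eq_bigr => w2 _.
    rewrite mulr_suml; apply: eq_bigl => w.
    by rewrite (eq_sym (f w1)) (eq_sym (c w2)).
  rewrite ler_pdivrMr // TE mulr_suml; apply: ler_sum => w1 _.
  by rewrite mul1r; apply: ler_sum => w2 _.
have S2 : \sum_w L w / (K (c w) * r (c w)) <= T.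
  rewrite TE (partition_big c xpredT) //= [leRHS](partition_big c xpredT) //=.
  apply: ler_sum => j _; rewrite -sumE -/(K j).
  have [w1 /eqP cw|none] := pickP (fun w => c w == j); last first.
    by rewrite big_pred0.
  rewrite (eq_bigr (fun w => L w / (K j * r j))) => [|w /eqP -> //].
  rewrite -mulr_suml ler_pdivrMr ?mulr_gt0 -?cw //.
  rewrite cw mulrA mulrC -expr2; apply: le_trans (coll j).
  apply: ler_sum => w /eqP cw'; rewrite /L sumE big_mkcond [leRHS]big_mkcond.
  apply: ler_sum => w' _; rewrite cw' inE eq_sym.
  by case: (f w == _); case: (c w' == _).
have pt w : - ln (r (c w)) <= - ln (N w / T) +
    ((N w / T) * (K (c w) / L w) - 1) + (L w / (K (c w) * r (c w)) - 1).
  have a1 : 0 < (N w / T) * (K (c w) / L w) by rewrite !(mulr_gt0, invr_gt0).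
  have a2 : 0 < L w / (K (c w) * r (c w)) by rewrite !(mulr_gt0, invr_gt0).
  have := ln_le_subr1 a1; have := ln_le_subr1 a2.
  have : ln (N w / T) = ln ((N w / T) * (K (c w) / L w)) +
     ln (L w / (K (c w) * r (c w))) + ln (r (c w)).
    rewrite -lnM ?posrE // -lnM ?posrE //; last exact: mulr_gt0.
    congr (ln _); field.
    by rewrite -/(K (c w)) -/(L w) -/T !gt_eqF.
  lra.
apply: (@le_trans _ _ (\sum_w (- ln (N w / T) +
    ((N w / T) * (K (c w) / L w) - 1) + (L w / (K (c w) * r (c w)) - 1)))).
  by apply: ler_sum => w _.
rewrite !big_split /= !sumrN -TE -!addrA gerDl.
lra.
Qed.

(** * Minimal polynomials over the integers *)

Lemma minpolyZP (R : realType) (lambda : R) :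
  algebraic_over_Z lambda -> is_minpolyZ lambda (minpolyZ lambda).
Proof.
move=> [q0 q00 q0l]; rewrite /minpolyZ; apply: (@xgetPex _ 0 [set p | is_minpolyZ lambda p]).
pose B n := `[< exists q : {poly int},
  [/\ q != 0, root (map_poly intr q) lambda & size q = n] >].
have exB : exists n, B n by exists (size q0); apply/asboolP; exists q0.
case: (ex_minnP exB) => m /asboolP[q [q_neq0 ql sq]] minm.
exists (zprimitive q); split.
- move: ql; rewrite {1}(zpolyEprim q) map_polyZ rootZ //.
  by rewrite intr_eq0 zcontents_eq0.
- by rewrite zcontents_primitive q_neq0.
- move=> q' q'0 q'l; rewrite size_zprimitive sq minm //.
  by apply/asboolP; exists q'.
Qed.

Lemma minpolyZ_neq0 (R : realType) (lambda : R) p : is_minpolyZ lambda p -> p != 0.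
Proof. by case=> _ c1 _; rewrite -zcontents_eq0 c1. Qed.

(** Pseudo-division by [p] leaves a remainder that vanishes by minimality, and
    Gauss's lemma turns divisibility over the rationals into divisibility over
    the integers. *)
Lemma minpolyZ_dvd (R : realType) (lambda : R) (p q : {poly int}) :
  is_minpolyZ lambda p -> root (map_poly intr q) lambda ->
  exists r, q = p * r.
Proof.
move=> pmin ql; have p0 := minpolyZ_neq0 pmin; case: pmin => pl p1 pmin.
have pq : p %| q.
  apply/Pdiv.Idomain.modp_eq0P/eqP; apply/negPn/negP => r0.
  have := pmin _ r0; rewrite leqNgt Pdiv.Idomain.ltn_modp p0 => /(_ _)/negP; apply => //.
  have /(congr1 (fun f => (map_poly (intr : int -> R) f).[lambda])) := Pdiv.Idomain.divp_eq q p.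
  rewrite map_polyZ rmorphD rmorphM hornerZ hornerD hornerM /=.
  by rewrite (rootP pl) (rootP ql) !mulr0 add0r /root => <-.
have [r ->] := dvdpP_int pq; exists r.
by rewrite [in RHS](zpolyEprim p) p1 scale1r.
Qed.

Lemma minpolyZ_monic (R : realType) (lambda : R) (p q : {poly int}) :
  is_minpolyZ lambda p -> root (map_poly intr q) lambda ->
  `|lead_coef q|%N = 1%N -> p \is monic.
Proof.
move=> pmin ql q1; have [r qE] := minpolyZ_dvd pmin ql.
case: pmin => _ p1 _; have := sgz_contents p; rewrite p1 sgz1 => sp.
have : `|lead_coef p|%N = 1%N.
  apply/eqP; rewrite -dvdn1 -q1 qE lead_coefM abszM dvdn_mulr //.
move=> ap; rewrite monicE -[lead_coef p]mulz_sign_abs ap mulr1.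
by move: sp; case: sgzP => // pp _; rewrite ltNge ltW.
Qed.

(** Split the complex roots of [G] into those of [p] outside the unit disc, to
    which Landau's inequality is applied, and a monic cofactor. *)
Lemma mahler_le_sqnorm (R : realType) (p : {poly int}) (G : {poly R}) :
  p \is monic -> G \is monic -> map_poly intr p %| G ->
  mahler_poly R p ^+ 2 <= sqnorm G.
Proof.
move=> pm Gm /dvdpP[H GE]; pose iota : {rmorphism R -> R[i]%C} := real_complex R.
rewrite /mahler_poly (monicP pm) normr1 mul1r; set s := complex_roots R p.
have sE : map_poly (intr : int -> R[i]%C) p = \prod_(z <- s) ('X - z%:P).
  rewrite /s /complex_roots; case: closed_field_poly_normal => r /= ->.
  by rewrite lead_coef_map_inj ?(monicP pm) ?scale1r //; exact: intr_inj.
pose A := \prod_(z <- [seq z <- s | 1 < Normc.normc z]) ('X - z%:P).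
pose B := \prod_(z <- s | ~~ (1 < Normc.normc z)) ('X - z%:P) * map_poly iota H.
have GAB : map_poly iota G = A * B.
  rewrite GE rmorphM /= -map_poly_comp (eq_map_poly (g := intr)) => [|z]; last exact: rmorph_int.
  by rewrite sE (bigID (fun z => 1 < Normc.normc z)) /= /A big_filter mulrC mulrA.
have Am : A \is monic by apply: monic_prod => z _; exact: monicXsubC.
have ABm : A * B \is monic by rewrite -GAB map_monic.
have Bm : B \is monic by rewrite (monicMl _ Am) in ABm.
have sB : (size B <= (size B).-1.+1)%N by exact: leqSpred.
have := landau_ineq [seq z <- s | 1 < Normc.normc z] sB.
rewrite -/A -GAB -lead_coefE (monicP Bm) normr1 expr1n mulr1 big_filter.
have -> : sqnorm (map_poly iota G) = iota (sqnorm G).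
  rewrite /sqnorm size_map_poly rmorph_sum; apply: eq_bigr => i _.
  rewrite coef_map /= rmorphXn /=; congr (_ ^+ 2).
  by rewrite /iota /= normc_def /= expr0n /= addr0 sqrtr_sqr.
rewrite (eq_bigr (fun z => iota (Normc.normc z ^+ 2))) => [|z _]; last first.
  by rewrite rmorphXn /=; case: z.
by rewrite -rmorph_prod /= lecR prodrXl.
Qed.

(** * Collisions of word sums and their entropy *)

Definition word_sum (R : realType) (lambda tau : R) n (w : word n) : R :=
  \sum_(i < n) Tform (w i).+1 1 tau * lambda ^+ i.

(** On words with the same free positions the contribution of [tau] cancels. *)
Lemma word_sumB (R : realType) (lambda tau : R) n (w w' : word n) :
  free w = free w' ->
  word_sum lambda tau w - word_sum lambda tau w' = (word_diff R w w').[lambda].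
Proof.
move=> ww'; rewrite /word_diff horner_sum -sumrB; apply: eq_bigr => i _.
rewrite hornerZ hornerXn -mulrBl; congr (_ * _).
have /setP/(_ i) := ww'; rewrite !inE /bit.
case: (w i) => [[|[|[|a]]] //= _]; case: (w' i) => [[|[|[|b]]] //= _] //; by rewrite !subrr.
Qed.

Lemma map_word_diff (R : realType) n (w w' : word n) :
  map_poly intr (word_diff int w w') = word_diff R w w'.
Proof.
rewrite /word_diff rmorph_sum; apply: eq_bigr => i _ /=.
by rewrite map_polyZ map_polyXn /= /bit rmorphB /= !rmorph_nat.
Qed.

Lemma coef_word_diff n (w w' : word n) (i : 'I_n) :
  (word_diff int w w')`_i = bit int (w i) - bit int (w' i).
Proof.
rewrite /word_diff coef_sum (bigD1 i) //= coefZ coefXn eqxx mulr1.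
rewrite big1 ?addr0 // => j ji; rewrite coefZ coefXn eq_sym.
by rewrite -[_ == _ :> nat]/(_ == _ :> 'I_n) (negbTE ji) mulr0.
Qed.

Lemma word_diff_lead n (w w' : word n) :
  word_diff int w w' != 0 -> `|lead_coef (word_diff int w w')|%N = 1%N.
Proof.
move=> q0; have := q0; rewrite -lead_coef_eq0 lead_coefE.
set m := (size _).-1; have [mn|nm] := ltnP m n.
  rewrite (coef_word_diff w w' (Ordinal mn)) /bit.
  by case: (nat_of_ord (w _) == _); case: (nat_of_ord (w' _) == _).
suff -> : (word_diff int w w')`_m = 0 by rewrite eqxx.
rewrite nth_default // (leq_trans _ nm) //.
apply: (leq_trans (size_sum _ _ _)); apply/bigmax_leqP => i _.
by rewrite (leq_trans (size_scale_leq _ _)) // size_polyXn.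
Qed.

Lemma word_diff_eq0 n (w w' : word n) :
  free w = free w' -> word_diff int w w' = 0 -> w = w'.
Proof.
move=> ww' q0; apply/ffunP => i; apply: val_inj.
have := coef_word_diff w w' i; rewrite q0 coef0.
have /setP/(_ i) := ww'; rewrite !inE /bit.
by case: (w i) => [[|[|[|a]]] //= _]; case: (w' i) => [[|[|[|b]]] //= _].
Qed.

(** If no nontrivial polynomial with coefficients in [{-1, 0, 1}] vanishes at
    [lambda], then words with the same free positions have different sums. Such
    a polynomial forces the minimal polynomial to be monic. *)
Lemma word_sum_collision (R : realType) (lambda tau : R) n (w w' : word n) :
  ~ (algebraic_over_Z lambda /\ minpolyZ lambda \is monic) ->
  free w = free w' -> word_sum lambda tau w = word_sum lambda tau w' -> w = w'.
Proof.
move=> nalg ww' /eqP; rewrite -subr_eq0 word_sumB // -map_word_diff => ql.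
apply: word_diff_eq0 => //; apply/eqP/negPn/negP => q0; apply: nalg.
have alg : algebraic_over_Z lambda by exists (word_diff int w w').
split=> //; apply: minpolyZ_monic (minpolyZP alg) ql _.
exact: word_diff_lead.
Qed.

Lemma card_class n (J : {set 'I_n}) :
  #|[pred w : word n | free w == J]| = (2 ^ #|J|)%N.
Proof.
pose F (i : 'I_n) : pred 'I_3 := if i \in J then [pred a : 'I_3 | (a < 2)%N]
  else [pred a : 'I_3 | (a == 2%N :> nat)].
have -> : #|[pred w : word n | free w == J]| = #|family F|.
  apply: eq_card => w; rewrite inE; apply/eqP/familyP => [wJ i|wF].
    rewrite /F -wJ inE; case: ifP => // /negbT; rewrite !inE -leqNgt => a2.
    by rewrite eqn_leq a2 -ltnS ltn_ord.
  apply/setP => i; rewrite inE; have := wF i; rewrite /F.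
  by case: (i \in J); rewrite inE // => /eqP ->.
have card2 : #|[pred a : 'I_3 | (a < 2)%N]| = 2%N.
  rewrite -sum1_card big_mkcond !big_ord_recl big_ord0 //=.
have card1 : #|[pred a : 'I_3 | (a == 2%N :> nat)]| = 1%N.
  rewrite -sum1_card big_mkcond !big_ord_recl big_ord0 //=.
rewrite card_family foldrE big_map big_enum /= -prod_nat_const [RHS]big_mkcond /=.
by apply: eq_bigr => i _; rewrite /F; case: ifP.
Qed.

(** Each position is free in two thirds of the words. *)
Lemma sum_card_free n : (3 * \sum_(w : word n) #|free w| = n * 2 * 3 ^ n)%N.
Proof.
have coord (k : 'I_n) : (3 * \sum_(w : word n) (w k < 2) = 2 * 3 ^ n)%N.
  pose F (i : 'I_n) (a : 'I_3) : nat := if i == k then (a < 2)%N : nat else 1%N.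
  have -> : (\sum_(w : word n) (w k < 2) = \sum_(w : word n) \prod_i F i (w i))%N.
    apply: eq_bigr => w _; rewrite (bigD1 k) //= {1}/F eqxx big1 ?muln1 // => i ik.
    by rewrite /F (negbTE ik).
  rewrite -bigA_distr_bigA (bigD1 k) //=.
  have -> : (\sum_(j < 3) F k j = 2)%N by rewrite /F eqxx !big_ord_recl big_ord0.
  rewrite (eq_bigr (fun=> 3)) => [|i ik]; last first.
    by rewrite /F (negbTE ik) sum_nat_const card_ord.
  rewrite prod_nat_const mulnCA -expnS; congr (_ * _ ^ _)%N.
  rewrite (eq_card (B := predC1 k)) // cardC1 card_ord prednK //.
  exact: leq_ltn_trans (ltn_ord k).
rewrite (eq_bigr (fun w : word n => \sum_(k < n) ((w k < 2) : nat))%N) => [|w _]; last first.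
  by rewrite -sum1_card big_mkcond; apply: eq_bigr => i _; rewrite inE; case: ifP.
rewrite exchange_big big_distrr /= (eq_bigr (fun=> (2 * 3 ^ n)%N)) => [|k _]; last exact: coord.
by rewrite sum_nat_const card_ord mulnA.
Qed.

Lemma word_entropy_ge (R : realType) (eps : R) : 0 < eps ->
  exists M : R, forall lambda tau : R, (M%:E < mahler lambda)%E ->
  forall n, n%:R * (2 / 3 * (ln 2 - eps)) <=
    unif_entropy R (word_sum lambda tau (n := n)).
Proof.
move=> e0; have [T HT] := collision_bound e0.
(* the bound [1] makes [M(lambda) ^+ 2 >= M(lambda)] *)
exists (Num.max 1 (T / eps)) => lambda tau Ml n.
set rho := expR eps / 2.
have rho0 : 0 < rho by rewrite divr_gt0 ?expR_gt0.
have rho2 : 1 <= 2 * rho.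
  by rewrite /rho mulrC divfK // -expR0 ler_expR ltW.
have lnrho : ln rho = eps - ln 2 by rewrite /rho ln_div ?posrE ?expR_gt0 // expRK.
have coll (J : {set 'I_n}) : \sum_(w : word n | free w == J) \sum_(w' : word n | free w' == J)
    (word_sum lambda tau w == word_sum lambda tau w')%:R <=
    rho ^+ #|J| * #|[pred w : word n | free w == J]|%:R ^+ 2.
  have [[alg pm]|nalg] := pselect (algebraic_over_Z lambda /\ minpolyZ lambda \is monic).
    have pmin := minpolyZP alg.
    move: Ml; rewrite /mahler asboolT // lte_fin gt_max => /andP[M1 MT].
    set p := minpolyZ lambda in pm pmin M1 MT.
    pose P : {poly R} := map_poly intr p.
    have Pm : P \is monic by apply: monic_map.
    have P0 : P != 0 by exact: monic_neq0.
    have TP k : T <= eps * (1 + lsq_form P k 'X^((size P).-1 + k) 'X^((size P).-1 + k)).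
      rewrite -ler_pdivrMl // mulrC; apply: (@le_trans _ _ (mahler_poly R p ^+ 2)).
        by rewrite expr2; nra.
      by apply: lsq_form_new_monomial P0 _ => G; exact: mahler_le_sqnorm.
    apply: le_trans (HT P P0 TP n J).
    apply: ler_sum => w /eqP wJ; apply: ler_sum => w' /eqP w'J; rewrite ler_nat.
    have [ww'|_] := eqVneq; last by [].
    have ql : root (map_poly intr (word_diff int w w')) lambda.
      by rewrite map_word_diff rootE -(word_sumB lambda tau) ?wJ ?w'J // ww' subrr.
    have [r qE] := minpolyZ_dvd pmin ql.
    by rewrite -map_word_diff qE rmorphM dvdp_mulr.
  rewrite (eq_bigr (fun=> 1)) => [|w /eqP wJ]; last first.
    rewrite (bigD1 w) /=; last by rewrite wJ.
    rewrite eqxx big1 ?addr0 // => w' /andP[/eqP w'J ww'].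
    case: eqVneq => // /(word_sum_collision nalg); rewrite wJ w'J => /(_ erefl) E.
    by rewrite E eqxx in ww'.
  have -> : \sum_(w : word n | free w == J) 1 =
    #|[pred w : word n | free w == J]|%:R :> R by rewrite -sumr_const; apply: eq_bigl.
  rewrite card_class natrX expr2 mulrA -exprMn [_ * 2]mulrC ler_peMl ?exprn_ege1 //.
have := unif_entropy_ge (fun J : {set 'I_n} => exprn_gt0 #|J| rho0) coll; apply: le_trans.
rewrite ler_pdivlMr ?ltr0n ?card_ffun ?card_ord ?expn_gt0 //.
rewrite (eq_bigr (fun w : word n => (ln 2 - eps) * #|free w|%:R)) => [|w _]; last first.
  by rewrite lnXn // lnrho -mulNrn opprB mulr_natr.
rewrite -mulr_sumr -natr_sum.
have /(congr1 (fun m => m%:R : R)) := sum_card_free n.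
rewrite !natrM; set S := (\sum_w _)%N%:R; set N := (3 ^ n)%N%:R => E.
have -> : S = n%:R * 2 * N / 3 by rewrite -E mulrC mulKf.
by rewrite le_eqVlt; apply/orP; left; apply/eqP; field.
Qed.

(** * Existence of the entropy rate *)

(** Fekete's lemma: division of [n] by [m] with remainder bounds [a n / n] by
    [a m / m] up to an error [O(1 / n)]. *)
Lemma subadditive_cvgn (R : realType) (a : nat -> R) :
  (forall n, 0 <= a n) -> (forall m n, a (m + n)%N <= a m + a n) ->
  cvgn (fun n => n%:R^-1 * a n).
Proof.
move=> a0 aD; pose E := [set n.+1%:R^-1 * a n.+1 | n in [set: nat]].
have E0 : lbound E 0 by move=> _ [n _ <-]; rewrite mulr_ge0 ?invr_ge0.
have hE : has_inf E by split; [exists (1%:R^-1 * a 1%N), 0%N | exists 0].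
have Lle n : inf E <= n.+1%:R^-1 * a n.+1.
  by apply: ge_inf; [exact: hE.2 | exists n].
apply/cvg_ex; exists (inf E); apply/cvgrPdist_le => /= e e0.
have e2 : 0 < e / 2 by rewrite divr_gt0.
have [_ [m _ <-] mL] := inf_adherent e2 hE.
pose C := \sum_(i < m.+1) a i.
have aqr q (r : 'I_m.+1) : a (q * m.+1 + r)%N <= q%:R * a m.+1 + C.
  elim: q => [|q IH].
    rewrite mul0r add0r add0n /C (bigD1 r) //= lerDl; exact: sumr_ge0.
  rewrite mulSn -addnA (le_trans (aD _ _)) // -natr1 mulrDl mul1r; lra.
have C0 : 0 <= C by exact: sumr_ge0.
near=> n; have n0 : (0 < n)%N by near: n; exact: nbhs_infty_gt.
have nR : 0 < n%:R :> R by rewrite ltr0n.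
have nC : 2 * C / e <= n%:R by near: n; exact: nbhs_infty_ger.
have Ln : inf E <= n%:R^-1 * a n by rewrite -(prednK n0).
rewrite distrC ger0_norm ?subr_ge0 // lerBlDl.
have an : a n <= (n %/ m.+1)%:R * a m.+1 + C.
  by rewrite {1}(divn_eq n m.+1); exact: (aqr _ (Ordinal (ltn_pmod n (ltn0Sn m)))).
set A := a m.+1 in mL an.
have qn : (n %/ m.+1)%:R * m.+1%:R <= n%:R :> R by rewrite -natrM ler_nat leq_trunc_div.
have mR : 0 < m.+1%:R :> R by rewrite ltr0n.
have An : (n %/ m.+1)%:R * A <= n%:R * (m.+1%:R^-1 * A).
  rewrite mulrA ler_wpM2r //; first exact: a0.
  by rewrite ler_pdivlMr.
have nC' : n%:R^-1 * C <= e / 2.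
  rewrite mulrC ler_pdivrMr //; move: nC; rewrite ler_pdivrMr //; lra.
apply: (@le_trans _ _ (m.+1%:R^-1 * A + n%:R^-1 * C)); last first.
  by apply: le_trans (lerD (ltW mL) nC') _; rewrite -addrA -splitr.
rewrite -(ler_pM2l nR) mulrDr !(mulVKf (lt0r_neq0 nR)).
by rewrite (le_trans an) // lerD2r.
Unshelve. all: by end_near.
Qed.

Definition cat_word n m (u : word n) (v : word m) : word (n + m) :=
  [ffun i => match fintype.split i with inl j => u j | inr j => v j end].

Lemma cat_word_lshift n m (u : word n) (v : word m) (i : 'I_n) :
  cat_word u v (lshift m i) = u i.
Proof. by rewrite ffunE (unsplitK (inl i)). Qed.

Lemma cat_word_rshift n m (u : word n) (v : word m) (i : 'I_m) :
  cat_word u v (rshift n i) = v i.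
Proof. by rewrite ffunE (unsplitK (inr i)). Qed.

Lemma cat_word_bij n m : bijective (fun x : word n * word m => cat_word x.1 x.2).
Proof.
exists (fun w : word (n + m) => ([ffun i => w (lshift m i)], [ffun i => w (rshift n i)])).
  move=> [u v] /=; congr (_, _); apply/ffunP => i;
  by rewrite ffunE ?cat_word_lshift ?cat_word_rshift.
move=> w; apply/ffunP => i /=; case: (split_ordP i) => j ->.
  by rewrite cat_word_lshift ffunE.
by rewrite cat_word_rshift ffunE.
Qed.

Lemma word_sum_cat (R : realType) (lambda tau : R) n m (u : word n) (v : word m) :
  word_sum lambda tau (cat_word u v) =
  word_sum lambda tau u + lambda ^+ n * word_sum lambda tau v.
Proof.
rewrite /word_sum big_split_ord /= mulr_sumr; congr (_ + _).
  by apply: eq_bigr => i _; rewrite cat_word_lshift.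
by apply: eq_bigr => i _; rewrite cat_word_rshift exprD mulrCA.
Qed.

Lemma unif_entropy_ge0 (R : realType) (W : finType) (V : eqType) (f : W -> V) :
  0 <= unif_entropy R f.
Proof.
rewrite divr_ge0 //; apply: sumr_ge0 => w _; rewrite oppr_ge0 ln_le0 //.
have W0 : (0 < #|W|)%N by apply/card_gt0P; exists w.
by rewrite ler_pdivrMr ?ltr0n // mul1r ler_nat max_card.
Qed.

(** Concatenating words with the same sums gives words with the same sum, so
    the fibre of a concatenation contains the product of the two fibres. *)
Lemma word_entropyD (R : realType) (lambda tau : R) n m :
  unif_entropy R (word_sum lambda tau (n := n + m)) <=
  unif_entropy R (word_sum lambda tau (n := n)) +
  unif_entropy R (word_sum lambda tau (n := m)).
Proof.
rewrite /unif_entropy !card_ffun !card_ord expnD natrM.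
set a : R := (3 ^ n)%N%:R; set b : R := (3 ^ m)%N%:R.
have a0 : 0 < a by rewrite ltr0n expn_gt0.
have b0 : 0 < b by rewrite ltr0n expn_gt0.
pose N k (w : word k) : R :=
  #|[pred w' : word k | word_sum lambda tau w' == word_sum lambda tau w]|%:R.
have N0 k (w : word k) : 0 < N k w by rewrite ltr0n; apply/card_gt0P; exists w; rewrite inE.
rewrite (reindex (fun x : word n * word m => cat_word x.1 x.2)) /=; last first.
  exact: onW_bij (cat_word_bij n m).
rewrite -(pair_bigA _ (fun u v => - ln (N _ (cat_word u v) / (a * b)))) /=.
have sumn (c : R) k : \sum_(w : word k) c = c * (3 ^ k)%N%:R.
  by rewrite sumr_const card_ffun !card_ord mulr_natr.
have -> : (\sum_(w : word n) - ln (N _ w / a)) / a + (\sum_(w : word m) - ln (N _ w / b)) / b =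
    (\sum_(u : word n) \sum_(v : word m) (- ln (N _ u / a) - ln (N _ v / b))) / (a * b).
  have inner (u : word n) : \sum_(v : word m) (- ln (N _ u / a) - ln (N _ v / b)) =
      - ln (N _ u / a) * b + \sum_(v : word m) - ln (N _ v / b).
    by rewrite big_split /= sumn.
  rewrite [in RHS](eq_bigr _ (fun u _ => inner u)).
  by rewrite big_split /= sumn -mulr_suml -/a; field; rewrite !gt_eqF.
rewrite ler_wpM2r ?invr_ge0 ?mulr_ge0 ?(ltW a0) ?(ltW b0) //.
apply: ler_sum => u _; apply: ler_sum => v _.
have ab0 : 0 < a * b by exact: mulr_gt0.
have pu : 0 < N _ u / a by exact: divr_gt0.
have pv : 0 < N _ v / b by exact: divr_gt0.
have puv : 0 < N _ (cat_word u v) / (a * b) by exact: divr_gt0.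
rewrite -opprD lerN2 -lnM ?posrE // ler_ln ?posrE //; last exact: mulr_gt0.
rewrite mulf_div ler_wpM2r ?invr_ge0 ?mulr_ge0 ?(ltW a0) ?(ltW b0) //.
rewrite -natrM ler_nat -cardX.
rewrite -(fintype.card_image (bij_inj (cat_word_bij n m))).
apply: subset_leq_card; apply/fintype.subsetP => _ /fintype.imageP[[u' v'] + ->] /=.
rewrite !inE /= !word_sum_cat => /andP[/eqP -> /eqP ->].
by rewrite eqxx.
Qed.

(** * The law of the random sum *)

Definition cylinder (Omega : Type) (xi : nat -> Omega -> nat) n (w : word n) : set Omega :=
  [set x | forall i : 'I_n, xi i x = (w i).+1].

Lemma digit_sum_cylinder (R : realType) (Omega : Type) (xi : nat -> Omega -> nat)
    (lambda tau : R) n (w : word n) x :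
  cylinder xi w x -> digit_sum xi lambda tau n x = word_sum lambda tau w.
Proof.
by move=> wx; rewrite /digit_sum big_mkord; apply: eq_bigr => i _; rewrite wx.
Qed.

Section RandomDigits.
Context (R : realType) (d : measure_display) (Omega : measurableType d).
Context (P : probability Omega R) (xi : nat -> {RV P >-> nat}).
Context (xi_indep : mutually_independent xi).
Context (xi_unif : forall k j : nat, (1 <= j <= 3)%N ->
  P (xi k @^-1` [set j]) = ((3 : R)^-1)%:E).

Local Notation cyl := (cylinder (fun k => xi k : Omega -> nat)).

Lemma cylinder_bigcap n (w : word n) (B : nat -> set nat) :
  (forall i : 'I_n, B i = [set (w i).+1]) ->
  cyl w = \bigcap_(j in [set` [fset val i | i in 'I_n]%fset]) (xi j @^-1` B j).
Proof.
move=> BE; apply/seteqP; split => [x wx _ /imfsetP[i _ ->]|x xB i] /=.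
  by rewrite BE; exact: wx.
by have := xB i; rewrite /= BE; apply; apply/imfsetP; exists i.
Qed.

Lemma cylinder_values n (w : word n) :
  exists B : nat -> set nat, forall i : 'I_n, B i = [set (w i).+1].
Proof.
exists (fun k => if insub k is Some i then [set (w i).+1] else setT) => i.
by rewrite valK.
Qed.

Lemma measurable_cylinder n (w : word n) : measurable (cyl w).
Proof.
have [B BE] := cylinder_values w; rewrite (cylinder_bigcap BE).
apply: fin_bigcap_measurable => // j _.
by rewrite -[_ @^-1` _]setTI; exact: measurable_funPT.
Qed.

Lemma probability_cylinder n (w : word n) : P (cyl w) = ((3 ^- n) : R)%:E.
Proof.
have [B BE] := cylinder_values w; rewrite (cylinder_bigcap BE) xi_indep //.
rewrite (eq_big_seq (fun=> ((3 : R)^-1)%:E)) => [|j /imfsetP[i _ ->]]; last first.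
  by rewrite BE xi_unif //= ltn_ord.
rewrite prodEFin big_const_seq count_predT -/(#|`_|) card_imfset /=; last exact: val_inj.
by rewrite size_enum_ord iter_mulr_1 exprVn.
Qed.

Lemma trivIset_cylinder n : trivIset [set: word n] (cyl (n := n)).
Proof.
move=> w w' _ _ [x [wx w'x]]; apply/ffunP => i; apply/val_inj/succn_inj.
by rewrite -(wx i) -(w'x i).
Qed.

(** The digits may leave [{1, 2, 3}] on a null set, so the cylinders do not cover
    [Omega] and only bound a probability from below. Since their probabilities
    add up to one, the bounds for a set and for its complement together give
    equality. *)
Lemma card_cylinder_le n (A : pred (word n)) (B : set Omega) :
  measurable B -> (forall w, A w -> cyl w `<=` B) ->
  ((#|A|%:R * 3 ^- n : R)%:E <= P B)%E.
Proof.
move=> mB AB; pose C := \bigcup_(w in [set` enum A]) cyl w.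
have mC : measurable C.
  by apply: fin_bigcup_measurable => // w _; exact: measurable_cylinder.
have -> : ((#|A|%:R * 3 ^- n : R)%:E = P C)%E.
  rewrite /C measure_fin_bigcup //; last by move=> w _; exact: measurable_cylinder.
    rewrite -fsbig_seq ?enum_uniq // (eq_bigr (fun=> ((3 ^- n) : R)%:E)) => [|w _].
      by rewrite sumEFin big_enum /= sumr_const mulr_natl.
    exact: probability_cylinder.
  exact: sub_trivIset (@trivIset_cylinder n).
apply: le_measure; [exact: mem_set|exact: mem_set|].
by apply: bigcup_sub => w /=; rewrite mem_enum; exact: AB.
Qed.

Lemma measurable_digit_sum (lambda tau : R) n :
  measurable_fun setT (digit_sum (fun k => xi k) lambda tau n : Omega -> R).
Proof.
rewrite /digit_sum; apply: measurable_sum => k.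
by apply: (measurableT_comp (f := fun j => Tform j 1 tau * lambda ^+ k)).
Qed.

Lemma probability_digit_sum (lambda tau : R) n (v : R) :
  P (digit_sum (fun k => xi k) lambda tau n @^-1` [set v]) =
  (#|[pred w : word n | word_sum lambda tau w == v]|%:R * 3 ^- n : R)%:E.
Proof.
set D := digit_sum _ _ _ _; set A := [pred w | _].
have mD : measurable (D @^-1` [set v]).
  by rewrite -[_ @^-1` _]setTI; exact: measurable_digit_sum.
have lo : ((#|A|%:R * 3 ^- n : R)%:E <= P (D @^-1` [set v]))%E.
  apply: card_cylinder_le => // w /eqP wv x wx.
  exact: etrans (digit_sum_cylinder lambda tau wx) wv.
have hi : ((#|predC A|%:R * 3 ^- n : R)%:E <= P (~` (D @^-1` [set v])))%E.
  apply: card_cylinder_le => [|w /negP wA x wx Dx]; first exact: measurableC.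
  by apply: wA; rewrite inE -(digit_sum_cylinder lambda tau wx); apply/eqP.
have cA : (#|A|%:R + #|predC A|%:R = 3 ^+ n :> R).
  by rewrite -natrD cardC card_ffun !card_ord natrX.
apply/eqP; rewrite eq_le lo andbT.
move: hi; rewrite probability_setC //.
have /fineK <- : P (D @^-1` [set v]) \is a fin_num by exact: fin_num_measure.
rewrite -EFinB !lee_fin.
have -> : #|A|%:R * 3 ^- n = 1 - #|predC A|%:R * 3 ^- n :> R.
  by apply/eqP; rewrite eq_sym subr_eq -mulrDl cA mulfV // expf_neq0.
lra.
Qed.

Lemma entropy_digit_sum (lambda tau : R) n :
  entropy P (digit_sum (fun k => xi k) lambda tau n) =
  unif_entropy R (word_sum lambda tau (n := n)).
Proof.
rewrite /entropy /unif_entropy card_ffun !card_ord; set D := digit_sum _ _ _ _.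
pose f : word n -> R := word_sum lambda tau (n := n).
pose s := [seq f w | w <- enum {: word n}].
pose p v : R := #|[pred w | f w == v]|%:R / (3 ^ n)%N%:R.
have pE v : fine (P (D @^-1` [set v])) = p v.
  by rewrite probability_digit_sum /= /p natrX.
rewrite (eq_fsbigr (fun v => - (p v * ln (p v)))) => [|v _]; last by rewrite pE.
have p0 v : v \notin s -> p v = 0.
  move=> vs; rewrite /p eq_card0 ?mul0r // => w; rewrite inE.
  apply: contraNF vs => /eqP <-; apply/mapP; exists w => //; exact: mem_enum.
have count_s v : count_mem v s = #|[pred w | f w == v]|.
  by rewrite /s count_map enumT cardE /enum_mem size_filter; apply: eq_count.
rewrite -(fsbig_widen [set` undup s] (range D)) => [|v /=|v /= [_]]; last 2 first.
- rewrite mem_undup => /mapP[w _ vw].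
  have [x Dx] : D @^-1` [set v] !=set0; last by exists x.
  apply/set0P/eqP => D0; have := probability_digit_sum lambda tau n v.
  rewrite -/D D0 measure0 => -[] /esym/eqP; apply/negP.
  rewrite mulf_neq0 ?invr_neq0 ?expf_neq0 // pnatr_eq0 -lt0n.
  by apply/card_gt0P; exists w; rewrite inE vw.
- by move/negP; rewrite mem_undup => /p0 ->; rewrite mul0r oppr0.
rewrite -fsbig_seq ?undup_uniq // mulr_suml.
transitivity (\sum_(v <- s) - ln (p v) / (3 ^ n)%N%:R).
  rewrite -[RHS]big_undup_iterop_count; apply: eq_bigr => v _.
  by rewrite Monoid.iteropE iter_addr_0 count_s /p -mulr_natr; ring.
by rewrite big_map big_enum.
Qed.

End RandomDigits.

Theorem theorem1p7 (R : realType) (d : measure_display)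
  (Omega : measurableType d) (P : probability Omega R)
  (xi : nat -> {RV P >-> nat})
  (xi_indep : mutually_independent xi)
  (xi_unif : forall k j : nat, (1 <= j <= 3)%N ->
     P (xi k @^-1` [set j]) = ((3 : R)^-1)%:E) :
  forall eps : R, 0 < eps ->
  exists M : R, forall lambda tau : R,
    0 < lambda -> lambda < 1 ->
    entropy_rate xi lambda tau < 2 / 3 * ln 2 - eps ->
    (mahler lambda <= M%:E)%E.
Proof.
move=> eps e0; have [M HM] := word_entropy_ge e0.
exists M => lambda tau _ _ hlt.
rewrite leNgt; apply/negP => /(HM lambda tau) Hn.
have rateE : entropy_rate xi lambda tau =
    limn (fun n => n%:R^-1 * unif_entropy R (word_sum lambda tau (n := n))).
  rewrite /entropy_rate.
  by under eq_fun do rewrite (entropy_digit_sum xi_indep xi_unif).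
have cv := subadditive_cvgn
  (fun n => unif_entropy_ge0 R (word_sum lambda tau (n := n)))
  (fun m n => word_entropyD lambda tau m n).
have : 2 / 3 * (ln 2 - eps) <= entropy_rate xi lambda tau.
  rewrite rateE; apply: (limr_ge cv); near=> n.
  have n0 : 0 < n%:R :> R by rewrite ltr0n; near: n; exact: nbhs_infty_gt.
  by rewrite ler_pdivlMl.
lra.
Unshelve. all: by end_near.
Qed.
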